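(* Let $(S,\mathcal{A},\mu)$ be a complete, $\sigma$-finite measure space and $X$ a real Banach space with property $( ** )$. Then $L^1(\mu,X)$ and $L^\infty(\mu,X)$ also have property $( ** )$.
   Context: For a real Banach space $X$, $y^*\in S_{X^*}$ and $\varepsilon>0$, $S(y^*,\varepsilon)=\{z\in B_X:y^*(z)>1-\varepsilon\}$, and $d(x,A)=\inf_{a\in A}\|x-a\|$. $X$ has property $( ** )$ if for all $x_1,x_2\in S_X$ and each $\varepsilon>0$ there is $y^*\in S_{X^*}$ with $x_1\in S(y^*,\varepsilon)$ and $d(x_2,S(y^*,\varepsilon))+d(x_2,-S(y^*,\varepsilon))<2+\varepsilon$. $L^1(\mu,X)$, $L^\infty(\mu,X)$ are the Lebesgue–Bochner spaces. *)

(* Defs.v *)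
From HB Require Import structures.
From mathcomp Require Import all_boot all_order all_algebra.
From mathcomp Require Import all_classical all_reals all_analysis.
From mathcomp Require Import ess_sup_inf.
Set Implicit Arguments. Unset Strict Implicit. Unset Printing Implicit Defensive.
Import Order.TTheory GRing.Theory Num.Theory numFieldNormedType.Exports.
Local Open Scope classical_set_scope.
Local Open Scope ring_scope.

(* (MathComp-Analysis).

   A (semi)normed space is presented as a triple (V, P, N): an R-vector space
   V, a subspace P of V (given as a predicate) and a seminorm N on P.  The
   normed space meant is the quotient of P by the null vectors {N = 0}; all
   notions below (spheres, balls, norm-one functionals, slices, distances)
   are stated on representatives and are invariant under this quotient. *)

Section StarStar.
Variables (R : realType) (V : lmodType R) (P : set V) (N : V -> R).

Definition dual_sphere (f : V -> R) : Prop :=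
  [/\ (forall x y, P x -> P y -> f (x + y) = f x + f y),
      (forall (a : R) x, P x -> f (a *: x) = a * f x),
      (forall z, P z -> N z <= 1 -> `|f z| <= 1) &
      (forall d : R, 0 < d -> exists2 z, P z /\ N z <= 1 & 1 - d < `|f z|)].

Definition slice (f : V -> R) (eps : R) : set V :=
  [set z | [/\ P z, N z <= 1 & 1 - eps < f z]].

Definition dist (x : V) (A : set V) : R := inf [set N (x - a) | a in A].

Definition property_ss : Prop :=
  forall x1 x2 : V, P x1 -> P x2 -> N x1 = 1 -> N x2 = 1 ->
  forall eps : R, 0 < eps ->
  exists f : V -> R, [/\ dual_sphere f, slice f eps x1 &
     dist x2 (slice f eps) + dist x2 [set - z | z in slice f eps] < 2 + eps].

End StarStar.

Definition banach_property_ss (R : realType) (X : completeNormedModType R) :=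
  property_ss [set: X] (fun x : X => `|x|).

Section Bochner.
Context (R : realType) (d : measure_display) (S : measurableType d)
        (X : normedModType R).
Variable mu : {measure set S -> \bar R}.

Definition simple_fun (s : S -> X) : Prop :=
  finite_set (range s) /\ (forall x : X, measurable (s @^-1` [set x])).

Definition strongly_measurable (f : S -> X) : Prop :=
  exists s : nat -> S -> X, (forall n, simple_fun (s n)) /\
    {ae mu, forall t, (fun n => s n t) @ \oo --> f t}.

Definition L1_pred : set (S -> X) := [set f | strongly_measurable f /\
  (\int[mu]_t (`|f t|)%:E < +oo)%E].
Definition L1_norm (f : S -> X) : R := fine (\int[mu]_t (`|f t|)%:E).

Definition Linfty_pred : set (S -> X) := [set f | strongly_measurable f /\
  (ess_sup mu (fun t => (`|f t|)%:E) < +oo)%E].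
Definition Linfty_norm (f : S -> X) : R := fine (ess_sup mu (fun t => (`|f t|)%:E)).

End Bochner.

(* Main.v *)
(* The norm-one functional in [property_ss] may be replaced by any
   contraction, so only functionals of the form [g |-> \int y(t) (g t)] with
   [y(t)] in the dual ball of [X] are needed.  In L^1, approximate [x1], [x2] by
   simple functions [s1], [s2] and apply the property of [X] at each [t] to the
   directions of [s1 t] and [s2 t]; rescaling by [|s2 t|] and integrating gives
   the functional and the two points.  In L^oo, take a set [B] of finite positive
   measure on which [|x1|] is nearly 1 and [x1], [x2] are nearly constant, apply
   the property of [X] to these values, average over [B], and modify [x2] and
   [- x2] only on [B]; as [|x2|] may be small on [B], the property is first
   extended from the sphere to the ball by convexity. *)
Require Import Defs.
From HB Require Import structures.
From mathcomp Require Import all_boot all_order all_algebra.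
From mathcomp Require Import all_classical all_reals all_analysis.
From mathcomp Require Import ess_sup_inf measurable_realfun.
From mathcomp Require Import ring lra.
Set Implicit Arguments. Unset Strict Implicit. Unset Printing Implicit Defensive.
Import Order.TTheory GRing.Theory Num.Theory numFieldNormedType.Exports.
Local Open Scope classical_set_scope.
Local Open Scope ring_scope.

(** * Reduction to contractions and explicit points of the slices *)

Definition contraction (R : realType) (V : lmodType R) (P : set V)
    (N : V -> R) (f : V -> R) : Prop :=
  [/\ forall x y, P x -> P y -> f (x + y) = f x + f y,
      forall (a : R) x, P x -> f (a *: x) = a * f x &
      forall z, P z -> N z <= 1 -> `|f z| <= 1].

(* The norm of the functional is immaterial: dividing a contraction by its norm,
   which is at most 1, only enlarges the values exceeding [1 - eps]. *)
Lemma property_ssP (R : realType) (V : lmodType R) (P : set V) (N : V -> R) :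
  (forall x, 0 <= N x) ->
  property_ss P N <->
  forall x1 x2 : V, P x1 -> P x2 -> N x1 = 1 -> N x2 = 1 ->
  forall eps : R, 0 < eps ->
  exists f z z', [/\ contraction P N f, 1 - eps < f x1,
    slice P N f eps z, slice P N f eps z' &
    N (x2 - z) + N (x2 + z') < 2 + eps].
Proof.
move=> N0; split=> H x1 x2 Px1 Px2 N1 N2 eps eps0.
  have [f [[fD fZ f1 _] sx1 lt2]] := H x1 x2 Px1 Px2 N1 N2 eps eps0.
  set A := [set N (x2 - a) | a in slice P N f eps] in lt2.
  set B := [set N (x2 - a) | a in [set - z | z in slice P N f eps]].
  have iA : has_inf A.
    by split; [exists (N (x2 - x1)), x1|exists 0 => _ [a _ <-]].
  have iB : has_inf B.
    split; last by exists 0 => _ [a _ <-].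
    by exists (N (x2 - - x1)), (- x1) => //; exists x1.
  have lt2' : inf A + inf B < 2 + eps by [].
  (* Half of the slack in the strict inequality: each infimum may be exceeded by less than [t], and
     the sum still stays below [2 + eps]. *)
  pose t := (2 + eps - (inf A + inf B)) / 2.
  have t0 : 0 < t by rewrite /t; lra.
  have [_ [z zs <-] lz] := inf_adherent t0 iA.
  have [_ [_ [z' zs' <-] <-] lz'] := inf_adherent t0 iB.
  exists f, z, z'; split => //; first by case: sx1.
  by move: lz lz'; rewrite opprK /t; lra.
(* The cap [1 / 2] makes every value above [1 - e] positive. Hence the norm [c] of [f] is positive,
   and multiplying such a value by [c^-1 >= 1] does not decrease it. *)
pose e := Num.min eps (1 / 2).
have e0 : 0 < e by rewrite lt_min eps0/=; lra.
have ee : e <= eps by rewrite ge_min lexx.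
have e2 : e <= 1 / 2 by rewrite ge_min lexx orbT.
have [f [z [z' [[fD fZ f1] fx1 [Pz Nz fz] [Pz' Nz' fz'] lt2]]]] :=
  H x1 x2 Px1 Px2 N1 N2 e e0.
pose B := [set `|f z| | z in [set z | P z /\ N z <= 1]].
have uB : ubound B 1 by move=> _ [y [Py Ny] <-]; exact: f1.
have hB : has_sup B.
  split; last by exists 1.
  by exists `|f z|, z.
have bB y : P y -> N y <= 1 -> `|f y| <= sup B.
  by move=> Py Ny; apply: ub_le_sup; [exists 1|exists y].
pose c := sup B.
have c1 : c <= 1 by apply: ge_sup => //; case: hB.
have c0 : 0 < c.
  apply: (@lt_le_trans _ _ `|f z|); last exact: bB.
  by apply: (@lt_le_trans _ _ (f z)); [lra|exact: ler_norm].
have scl r : 1 - e < r -> 1 - eps < c^-1 * r.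
  move=> er; have : r <= c^-1 * r.
    by rewrite ler_peMl ?invf_ge1//; lra.
  by lra.
have slc y : P y -> N y <= 1 -> 1 - e < f y ->
    slice P N (fun y => c^-1 * f y) eps y.
  by move=> Py Ny fy; split => //; exact: scl.
exists (fun y => c^-1 * f y); split.
- split.
  + by move=> x y Px Py; rewrite fD// mulrDr.
  + by move=> a x Px; rewrite fZ// mulrCA.
  + move=> y Py Ny; rewrite normrM gtr0_norm ?invr_gt0//.
    by rewrite ler_pdivrMl// mulr1 bB.
  (* An error [t * c] in approaching the supremum [c] becomes [t] after division by [c]. *)
  + move=> t t0; have tc0 : 0 < t * c by rewrite mulr_gt0.
    have [_ [y [Py Ny] <-] ly] := sup_adherent tc0 hB.
    exists y => //; rewrite normrM gtr0_norm ?invr_gt0//.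
    rewrite ltr_pdivlMl//; apply: le_lt_trans ly.
    by rewrite -/c; lra.
- by apply: slc => //; rewrite N1.
- apply: le_lt_trans (lt_le_trans lt2 _); last by rewrite lerD2l.
  apply: lerD; apply: ge_inf; try by exists 0 => _ [a _ <-].
    by exists z => //; exact: slc.
  by exists (- z'); [exists z' => //; exact: slc|rewrite opprK].
Qed.

(** * The property of [X] for vectors of arbitrary norm *)

Definition dual_ball (R : realType) (X : normedModType R) (f : X -> R) : Prop :=
  [/\ forall x y, f (x + y) = f x + f y,
      forall (a : R) x, f (a *: x) = a * f x &
      forall x, `|f x| <= `|x|].

Lemma contraction_dual_ball (R : realType) (X : normedModType R) (f : X -> R) :
  contraction [set: X] (fun x : X => `|x|) f -> dual_ball f.
Proof.
move=> [fD fZ f1]; split=> [x y|a x|x]; [exact: fD|exact: fZ|].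
have [->|x0] := eqVneq x 0.
  by rewrite -(scale0r 0) fZ// mul0r normr0.
have nx : 0 < `|x| by rewrite normr_gt0.
have := f1 (`|x|^-1 *: x) I.
rewrite normrZ normfV normr_id mulVf ?gt_eqF// => /(_ (lexx _)).
by rewrite fZ// normrM normfV normr_id ler_pdivrMl// mulr1.
Qed.

Lemma dual_ballB (R : realType) (X : normedModType R) (f : X -> R) (x y : X) :
  dual_ball f -> f (x - y) = f x - f y.
Proof. by move=> [fD fZ _]; rewrite fD -scaleN1r fZ mulN1r. Qed.

Lemma dual_ball0 (R : realType) (X : normedModType R) :
  dual_ball (fun _ : X => 0 : R).
Proof.
by split=> *; rewrite ?addr0 ?mulr0// normr0.
Qed.

(* [f] nearly norms [u], and [z], [z'] are points of the ball of radius [r] on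
   which [f] is nearly maximal and which realise the two distances of [v]. *)
Definition ss_witness (R : realType) (X : normedModType R) (e r : R) (u v : X)
    (f : X -> R) (z z' : X) : Prop :=
  [/\ dual_ball f, (1 - e) * `|u| <= f u, `|z| <= r /\ `|z'| <= r,
      (1 - e) * r <= f z /\ (1 - e) * r <= f z' &
      `|v - z| + `|v + z'| <= (2 + e) * r].

Lemma ss_witness_sphere (R : realType) (X : completeNormedModType R)
    (u v : X) (e : R) :
  banach_property_ss X -> `|u| = 1 -> `|v| = 1 -> 0 < e ->
  exists f z z', ss_witness e 1 u v f z z'.
Proof.
move=> ssX u1 v1 e0.
have N0 (x : X) : 0 <= `|x| by [].
have [f [z [z' [cf fu [_ Nz fz] [_ Nz' fz'] vz]]]] :=
  (property_ssP [set: X] N0).1 ssX u v I I u1 v1 e e0.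
exists f, z, z'; split => //; first exact: contraction_dual_ball.
- by rewrite u1 mulr1 ltW.
- by rewrite mulr1 !ltW.
- by rewrite mulr1 ltW.
Qed.

(** The condition on [u] is homogeneous by itself, and those on [v], [z], [z'] and the radius are
    homogeneous together. The two factors are therefore independent, and either may be 0. *)
Lemma ss_witness_scale (R : realType) (X : normedModType R) (e a b : R)
    (u v : X) (f : X -> R) (z z' : X) :
  0 <= a -> 0 <= b -> ss_witness e 1 u v f z z' ->
  ss_witness e b (a *: u) (b *: v) f (b *: z) (b *: z').
Proof.
move=> a0 b0 [fb fu [z1 z1'] [fz fz'] vz]; have [fD fZ _] := fb; split => //.
- by rewrite normrZ ger0_norm// fZ mulrCA ler_wpM2l.
- by rewrite !normrZ ger0_norm// !ler_piMr.
- by rewrite !fZ mulrC -(mulr1 (1 - e)) !ler_wpM2l.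
- rewrite -scalerBr -scalerDr !normrZ ger0_norm// -mulrDr mulrC.
  by rewrite ler_wpM2r// -[leRHS]mulr1.
Qed.

Lemma normalize_norm (R : realType) (X : normedModType R) (u : X) : u != 0 ->
  `| `|u|^-1 *: u | = 1.
Proof. by move=> u0; rewrite normrZ normfV normr_id mulVf ?normr_eq0. Qed.

Lemma normalizeK (R : realType) (X : normedModType R) (u : X) : u != 0 ->
  `|u| *: (`|u|^-1 *: u) = u.
Proof. by move=> u0; rewrite scalerA mulfV ?scale1r ?normr_eq0. Qed.

(** This is the form applied pointwise in L^1, where both vectors may vanish and the radius has to
    follow [|v|]. A zero vector has no direction, so it borrows that of the other one and is
    recovered with the factor 0. *)
Lemma ss_witness_norm (R : realType) (X : completeNormedModType R)
    (u v : X) (e : R) :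
  banach_property_ss X -> 0 < e -> exists f z z', ss_witness e `|v| u v f z z'.
Proof.
move=> ssX e0.
have [v0|v0] := eqVneq v 0; have [u0|u0] := eqVneq u 0.
- exists (fun=> 0), 0, 0; rewrite u0 v0; split.
  + exact: dual_ball0.
  + by rewrite normr0 mulr0.
  + by rewrite lexx.
  + by rewrite normr0 mulr0 lexx.
  + by rewrite subr0 addr0 normr0 mulr0 addr0.
- have [f [z [z' w]]] := ss_witness_sphere ssX (normalize_norm u0)
    (normalize_norm u0) e0.
  exists f, (0 *: z), (0 *: z').
  have := ss_witness_scale (normr_ge0 u) (lexx 0) w.
  by rewrite normalizeK// !scale0r v0 normr0.
- have [f [z [z' w]]] := ss_witness_sphere ssX (normalize_norm v0)
    (normalize_norm v0) e0.
  exists f, (`|v| *: z), (`|v| *: z').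
  have := ss_witness_scale (lexx 0) (normr_ge0 v) w.
  by rewrite normalizeK// scale0r u0.
- have [f [z [z' w]]] := ss_witness_sphere ssX (normalize_norm u0)
    (normalize_norm v0) e0.
  exists f, (`|v| *: z), (`|v| *: z').
  have := ss_witness_scale (normr_ge0 u) (normr_ge0 v) w.
  by rewrite !normalizeK.
Qed.

(* [v = r w] is the convex combination with weights [(1 + r) / 2] and
   [(1 - r) / 2] of [w] and [- w], and for [- w] the two distances are those of
   [w] in the other order. *)
Lemma ss_witness_convex (R : realType) (X : normedModType R) (e r : R)
    (u w : X) (f : X -> R) (z z' : X) :
  0 <= r <= 1 -> ss_witness e 1 u w f z z' ->
  exists y y', ss_witness e 1 u (r *: w) f y y'.
Proof.
move=> /andP[r0 r1] [fb fu [z1 z1'] [fz fz'] vz]; have [fD fZ _] := fb.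
pose a := (1 + r) / 2; pose b := (1 - r) / 2.
have a0 : 0 <= a by rewrite /a; lra.
have b0 : 0 <= b by rewrite /b; lra.
have ab : a + b = 1 by rewrite /a /b; lra.
have rE : r = a - b by rewrite /a /b; lra.
clearbody a b.
have conv (x y s : R) : x <= s -> y <= s -> a * x + b * y <= s.
  move=> xs ys; rewrite -[s]mul1r -ab mulrDl.
  by apply: lerD; rewrite ler_wpM2l.
have norm_comb (x y : X) : `|a *: x + b *: y| <= a * `|x| + b * `|y|.
  by rewrite (le_trans (ler_normD _ _))// !normrZ (ger0_norm a0) (ger0_norm b0).
have norm_combB (x y : X) : `|a *: x - b *: y| <= a * `|x| + b * `|y|.
  by rewrite (le_trans (ler_normB _ _))// !normrZ (ger0_norm a0) (ger0_norm b0).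
exists (a *: z + b *: z'), (a *: z' + b *: z); split => //.
- by split; apply: le_trans (norm_comb _ _) _; exact: conv.
- rewrite !fD !fZ mulr1; move: fz fz'; rewrite mulr1 => fz fz'.
  have -> : 1 - e = a * (1 - e) + b * (1 - e) by rewrite -mulrDl ab mul1r.
  by split; apply: lerD; rewrite ler_wpM2l.
- have -> : r *: w - (a *: z + b *: z') = a *: (w - z) - b *: (w + z').
    rewrite rE scalerBl scalerBr scalerDr !opprD !addrA.
    by congr (_ + _); rewrite addrAC.
  have -> : r *: w + (a *: z' + b *: z) = a *: (w + z') - b *: (w - z).
    rewrite rE scalerBl scalerBr scalerDr !opprD opprK !addrA.
    by congr (_ + _); rewrite addrAC.
  apply: le_trans (lerD (norm_combB _ _) (norm_combB _ _)) _.
  apply: le_trans vz.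
  rewrite -[leRHS]mul1r -ab; lra.
Qed.

(** This is the form for L^oo, where the radius stays 1 although [v] may be short. The vector [v] is
    [|v|] times a unit vector [w], to which the convexity argument applies; when [v = 0], the
    direction of [u] serves as [w]. *)
Lemma ss_witness_ball (R : realType) (X : completeNormedModType R)
    (u v : X) (e : R) :
  banach_property_ss X -> u != 0 -> `|v| <= 1 -> 0 < e ->
  exists f z z', ss_witness e 1 u v f z z'.
Proof.
move=> ssX u0 v1 e0.
pose w := if v == 0 then `|u|^-1 *: u else `|v|^-1 *: v.
have w1 : `|w| = 1 by rewrite /w; case: eqVneq => [_|v0]; exact: normalize_norm.
have vE : v = `|v| *: w.
  rewrite /w; case: eqVneq => [->|v0]; last by rewrite normalizeK.
  by rewrite normr0 scale0r.
have [f [z [z' wi]]] :=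
  ss_witness_sphere ssX (normalize_norm u0) w1 e0.
have r01 : 0 <= `|v| <= 1 by rewrite normr_ge0.
have [y [y' wi']] := ss_witness_convex r01 wi.
exists f, y, y'.
have := ss_witness_scale (normr_ge0 u) ler01 wi'.
by rewrite -vE normalizeK// !scale1r.
Qed.

(** * Measurable maps with finitely many values *)

Section finite_valued.
Context (d : measure_display) (S : measurableType d).

(** For a normed target this unfolds to the same proposition as [simple_fun]. An arbitrary target
    type allows pairs of vectors and booleans as values. *)
Definition finite_valued (T : Type) (p : S -> T) : Prop :=
  finite_set (range p) /\ forall x, measurable (p @^-1` [set x]).

Lemma finite_valued_preimage (T : Type) (p : S -> T) (A : set T) :
  finite_valued p -> measurable (p @^-1` A).
Proof.
move=> [fp mp].
have -> : p @^-1` A = \bigcup_(x in range p `&` A) p @^-1` [set x].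
  apply/seteqP; split=> [t At|t [x [_ Ax] /= ->//]].
  by exists (p t) => //; split => //; exists t.
by apply: fin_bigcup_measurable => [|x _]; [exact: finite_setIl|exact: mp].
Qed.

Lemma finite_valued_comp (T U : Type) (F : T -> U) (p : S -> T) :
  finite_valued p -> finite_valued (F \o p).
Proof.
move=> fp; split=> [|u].
  by rewrite -(image_comp p F); apply: finite_image; case: fp.
exact: (@finite_valued_preimage _ p (F @^-1` [set u])).
Qed.

Lemma finite_valued_pair (T U : Type) (p : S -> T) (q : S -> U) :
  finite_valued p -> finite_valued q -> finite_valued (fun t => (p t, q t)).
Proof.
move=> [fp mp] [fq mq]; split=> [|[x y]].
  apply: (@sub_finite_set _ _ (range p `*` range q)); last exact: finite_setX.
  by move=> _ [t _ <-]; split; exists t.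
have -> : (fun t => (p t, q t)) @^-1` [set (x, y)] =
    p @^-1` [set x] `&` q @^-1` [set y].
  by apply/seteqP; split=> t /= => [[-> ->]|[-> ->]].
exact: measurableI.
Qed.

Lemma finite_valued_mem (B : set S) :
  measurable B -> finite_valued (fun t => t \in B).
Proof.
move=> mB; split=> [|b]; first exact: finite_finset.
case: b.
  have -> // : (fun t => t \in B) @^-1` [set true] = B.
  by apply/seteqP; split=> t /=; [exact: set_mem|exact: mem_set].
have -> : (fun t => t \in B) @^-1` [set false] = ~` B.
  apply/seteqP; split=> t /=; last exact: memNset.
  by move=> tB Bt; rewrite mem_set in tB.
exact: measurableC.
Qed.

Lemma finite_valued_if (T : Type) (B : set S) (p q : S -> T) :
  measurable B -> finite_valued p -> finite_valued q ->
  finite_valued (fun t => if t \in B then p t else q t).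
Proof.
move=> /finite_valued_mem fB fp fq.
exact: (@finite_valued_comp _ _
  (fun w : bool * (T * T) => if w.1 then w.2.1 else w.2.2)
  _ (finite_valued_pair fB (finite_valued_pair fp fq))).
Qed.

Lemma finite_valued_cst (T : Type) (x : T) : finite_valued (fun _ : S => x).
Proof.
split=> [|y].
  by apply: (@sub_finite_set _ _ [set x]) => // _ [t _ <-].
have [->|xy] := pselect (x = y).
  by rewrite [X in measurable X](_ : _ = setT)//; apply/seteqP; split.
by rewrite [X in measurable X](_ : _ = set0)//; apply/seteqP; split.
Qed.

(** Meant for [t |-> y(t) (g t)] with a functional [y(t)] that depends on [t] only through [p t]: on
    each of the finitely many fibres of [p] the functional is fixed. *)
Lemma measurable_finite_valued (R : realType) (T : Type) (p : S -> T)
    (h : T -> S -> R) :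
  finite_valued p -> (forall x, measurable_fun [set: S] (h x)) ->
  measurable_fun [set: S] (fun t => h (p t) t).
Proof.
move=> [fp mp] mh _ B mB; rewrite setTI.
have -> : (fun t => h (p t) t) @^-1` B =
    \bigcup_(x in range p) (p @^-1` [set x] `&` h x @^-1` B).
  apply/seteqP; split=> [t Bt|t [x _ /= [-> //]]].
  by exists (p t) => //; exists t.
apply: fin_bigcup_measurable => // x _; apply: measurableI => //.
by rewrite -[X in measurable X]setTI; exact: mh.
Qed.

End finite_valued.

(** * Strongly measurable functions *)

Section strong_measurability.
Context (R : realType) (d : measure_display) (S : measurableType d)
        (mu : {measure set S -> \bar R}).

Lemma strongly_measurable_simple (X : normedModType R) (s : S -> X) :
  finite_valued s -> strongly_measurable mu s.
Proof.
by move=> fs; exists (fun=> s); split => //; apply: aeW => t; exact: cvg_cst.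
Qed.

Lemma strongly_measurable_comp2 (X Y Z : normedModType R) (F : X -> Y -> Z)
    (f : S -> X) (g : S -> Y) :
  (forall (u : nat -> X) (v : nat -> Y) x y, u @ \oo --> x -> v @ \oo --> y ->
    (fun n => F (u n) (v n)) @ \oo --> F x y) ->
  strongly_measurable mu f -> strongly_measurable mu g ->
  strongly_measurable mu (fun t => F (f t) (g t)).
Proof.
move=> cF [s [fs sf]] [r [fr rg]].
exists (fun n t => F (s n t) (r n t)); split=> [n|].
  exact: (@finite_valued_comp _ _ _ _ (fun w : X * Y => F w.1 w.2) _
    (finite_valued_pair (fs n) (fr n))).
by apply: filterS2 sf rg => t; exact: cF.
Qed.

Lemma strongly_measurableD (X : normedModType R) (f g : S -> X) :
  strongly_measurable mu f -> strongly_measurable mu g ->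
  strongly_measurable mu (f + g).
Proof.
by apply: (strongly_measurable_comp2 (F := fun x y => x + y)) => u v x y;
  exact: cvgD.
Qed.

Lemma strongly_measurableN (X : normedModType R) (f : S -> X) :
  strongly_measurable mu f -> strongly_measurable mu (- f).
Proof.
move=> mf.
apply: (strongly_measurable_comp2 (F := fun x _ => - x) _ mf mf)
  => u v x y ux _.
exact: cvgN.
Qed.

Lemma strongly_measurableB (X : normedModType R) (f g : S -> X) :
  strongly_measurable mu f -> strongly_measurable mu g ->
  strongly_measurable mu (f - g).
Proof.
by move=> mf mg; apply: strongly_measurableD => //; exact: strongly_measurableN.
Qed.

Lemma strongly_measurable_if (X : normedModType R) (B : set S) (c : X)
    (g : S -> X) : measurable B -> strongly_measurable mu g ->
  strongly_measurable mu (fun t => if t \in B then c else g t).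
Proof.
move=> mB [s [fs sg]]; exists (fun n t => if t \in B then c else s n t).
split=> [n|].
  by apply: finite_valued_if => //; [exact: finite_valued_cst|exact: fs].
apply: filterS sg => t st; case: ifP => // _; exact: cvg_cst.
Qed.

(** Off a null set, [psi \o g] is the pointwise limit of the measurable functions [psi \o s n];
    completeness of [mu] absorbs the null set. *)
Lemma measurable_comp_strongly_measurable (X : normedModType R) (psi : X -> R)
    (g : S -> X) : measure_is_complete mu -> continuous psi ->
  strongly_measurable mu g -> measurable_fun [set: S] (psi \o g).
Proof.
move=> cmu cpsi [s [fs [N [mN N0 sN]]]].
(* Multiplying by the indicator of the complement of [N] turns almost everywhere convergence into
   convergence at every point. *)
pose h n t := psi (s n t) * \1_(~` N) t.
have mh n : measurable_fun [set: S] (h n).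
  apply: measurable_funM; last exact: measurable_indic (measurableC mN).
  by apply: (@measurable_finite_valued _ _ _ _ (s n) (fun x _ => psi x)) => //;
    exact: fs.
have hc t : (h ^~ t) @ \oo --> psi (g t) * \1_(~` N) t.
  rewrite /h indicE; have [tN|tN] := boolP (t \in ~` N).
    have st : (fun n => s n t) @ \oo --> g t.
      by apply: contrapT => nst; exact: (set_mem tN) (sN t nst).
    by apply: cvgMr_tmp; apply: cvg_comp st (cpsi (g t)).
  rewrite mulr0 [X in X @ _](_ : _ = fun=> 0); first exact: cvg_cst.
  by apply/funext => n; rewrite mulr0.
have m := measurable_fun_cvg mh (fun t _ => hc t).
apply/measurable_EFinP.
apply: (@ae_measurable_fun _ _ _ mu cmu _
    (EFin \o (fun t => psi (g t) * \1_(~` N) t))).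
  exists N; split => // t /= /not_implyP[_ nE].
  by apply: contrapT => tN; apply: nE; rewrite /= indicE mem_set// mulr1.
exact/measurable_EFinP.
Qed.

Lemma measurable_norm_strongly_measurable (X : normedModType R) (g : S -> X) :
  measure_is_complete mu -> strongly_measurable mu g ->
  measurable_fun [set: S] (fun t => `|g t|).
Proof.
move=> cmu mg.
by apply: (measurable_comp_strongly_measurable cmu _ mg);
  exact: norm_continuous.
Qed.

End strong_measurability.

Lemma dual_ball_continuous (R : realType) (X : normedModType R) (f : X -> R) :
  dual_ball f -> continuous f.
Proof.
move=> df x; have [_ _ f1] := df.
apply/cvgrPdist_le => e e0; near=> y.
rewrite -dual_ballB// (le_trans (f1 _))//; near: y.
Unshelve. all: by end_near. Qed.

(** * Integrability of real combinations *)

Section real_integrable.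
Context (R : realType) (d : measure_display) (S : measurableType d)
        (mu : {measure set S -> \bar R}) (D : set S).
Hypothesis mD : measurable D.
Implicit Types f g : S -> R.

Lemma integrable_realD f g :
  mu.-integrable D (EFin \o f) -> mu.-integrable D (EFin \o g) ->
  mu.-integrable D (EFin \o (fun t => f t + g t)).
Proof. by move=> fi gi; exact: (integrableD mD fi gi). Qed.

Lemma integrable_realB f g :
  mu.-integrable D (EFin \o f) -> mu.-integrable D (EFin \o g) ->
  mu.-integrable D (EFin \o (fun t => f t - g t)).
Proof. by move=> fi gi; exact: (integrableB mD fi gi). Qed.

Lemma integrable_realZ (a : R) f : mu.-integrable D (EFin \o f) ->
  mu.-integrable D (EFin \o (fun t => a * f t)).
Proof. by move=> fi; exact: (integrableZl mD a fi). Qed.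

End real_integrable.

(** * The space L^1 and approximation by simple functions *)

Section L1.
Context (R : realType) (d : measure_display) (S : measurableType d)
        (mu : {measure set S -> \bar R}) (X : normedModType R).
Hypothesis cmu : measure_is_complete mu.

Lemma integrable_L1 (f : S -> X) :
  L1_pred mu f -> mu.-integrable [set: S] (EFin \o (fun t => `|f t|)).
Proof.
move=> [mf foo]; apply/integrableP; split.
  by apply/measurable_EFinP;
    exact: (measurable_norm_strongly_measurable cmu mf).
apply: le_lt_trans foo; rewrite le_eqVlt; apply/orP; left; apply/eqP.
by apply: eq_integral => t _ /=; rewrite normr_id.
Qed.

Lemma le_L1_pred (f : S -> X) (h : S -> R) :
  strongly_measurable mu f -> mu.-integrable [set: S] (EFin \o h) ->
  (forall t, `|f t| <= h t) -> L1_pred mu f.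
Proof.
move=> mf ih fh; split => //.
have /integrableP[_] : mu.-integrable [set: S] (EFin \o (fun t => `|f t|)).
  apply: le_integrable ih => //.
    by apply/measurable_EFinP;
    exact: (measurable_norm_strongly_measurable cmu mf).
  by move=> t _ /=; rewrite lee_fin normr_id (le_trans (fh t))// ler_norm.
apply: le_lt_trans; rewrite le_eqVlt; apply/orP; left; apply/eqP.
by apply: eq_integral => t _ /=; rewrite normr_id.
Qed.

Lemma L1_predB (f g : S -> X) :
  L1_pred mu f -> L1_pred mu g -> L1_pred mu (f - g).
Proof.
move=> Lf Lg; apply: (@le_L1_pred _ (fun t => `|f t| + `|g t|)).
- by apply: strongly_measurableB; [case: Lf|case: Lg].
- by apply: integrable_realD => //; exact: integrable_L1.
- by move=> t; exact: ler_normB.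
Qed.

Lemma L1_predN (f : S -> X) : L1_pred mu f -> L1_pred mu (- f).
Proof.
move=> Lf; apply: (@le_L1_pred _ (fun t => `|f t|)).
- by apply: strongly_measurableN; case: Lf.
- exact: integrable_L1.
- by move=> t; rewrite normrN.
Qed.

Lemma L1_predZ (a : R) (f : S -> X) : finite_valued f ->
  L1_pred mu f -> L1_pred mu (a *: f).
Proof.
move=> ff Lf; apply: (@le_L1_pred _ (fun t => `|a| * `|f t|)).
- apply: strongly_measurable_simple.
  exact: (finite_valued_comp (fun x => a *: x) ff).
- by apply: integrable_realZ => //; exact: integrable_L1.
- by move=> t; rewrite normrZ.
Qed.

Lemma L1_normE (f : S -> X) : L1_norm mu f = \int[mu]_t `|f t|.
Proof. by []. Qed.

Lemma L1_normZ (a : R) (f : S -> X) : L1_pred mu f ->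
  L1_norm mu (a *: f) = `|a| * L1_norm mu f.
Proof.
move=> Lf; rewrite !L1_normE -RintegralZl//; last exact: integrable_L1.
by apply: eq_Rintegral => t _; rewrite normrZ.
Qed.

Lemma L1_norm_triangle (f g h : S -> X) :
  L1_pred mu f -> L1_pred mu g -> L1_pred mu h ->
  L1_norm mu (f - h) <= L1_norm mu (f - g) + L1_norm mu (g - h).
Proof.
move=> Lf Lg Lh; have Lfg := L1_predB Lf Lg; have Lgh := L1_predB Lg Lh.
rewrite !L1_normE -RintegralD//; try exact: integrable_L1.
apply: le_Rintegral => //; first by apply: integrable_L1; exact: L1_predB.
  by apply: integrable_realD => //; exact: integrable_L1.
by move=> t _; exact: ler_distD.
Qed.

(* The simple functions converging almost everywhere to [x] are cut off where
   they exceed [2 |x|]; this brings them closer to [x] and makes them dominated. *)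
Lemma L1_simple_approx (x : S -> X) (e : R) : L1_pred mu x -> 0 < e ->
  exists s, [/\ finite_valued s, L1_pred mu s & L1_norm mu (x - s) < e].
Proof.
move=> Lx e0; have [mx xoo] := Lx; have [s [fs sx]] := mx.
pose B n := [set t | `|s n t| <= 2 * `|x t|].
have mB n : measurable (B n).
  rewrite -[B n]setTI; apply: measurable_fun_le => //.
    apply: (measurable_norm_strongly_measurable cmu).
    by apply: strongly_measurable_simple; exact: fs.
  by apply: measurable_funM => //;
    exact: (measurable_norm_strongly_measurable cmu mx).
pose r n t := if t \in B n then s n t else 0.
have fr n : finite_valued (r n).
  by apply: finite_valued_if => //; [exact: fs|exact: finite_valued_cst].
have r2 n t : `|r n t| <= 2 * `|x t|.
  rewrite /r; case: ifPn => [/set_mem//|_].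
  by rewrite normr0 mulr_ge0.
have Lr n : L1_pred mu (r n).
  apply: (@le_L1_pred _ (fun t => 2 * `|x t|)) => //.
    exact: strongly_measurable_simple.
  by apply: integrable_realZ => //; exact: integrable_L1.
(* Where the cut-off acts, [|s n t| > 2 |x t|], so [s n t] is farther than [|x t|] from [x t], while
   0 is at distance exactly [|x t|]. *)
have rs n t : `|x t - r n t| <= `|x t - s n t|.
  rewrite /r; case: ifPn => //; rewrite notin_setE /B/= => /negP.
  rewrite -ltNge subr0 => xs; rewrite distrC.
  by have := lerB_dist (s n t) (x t); lra.
have rx : {ae mu, forall t, [set: S] t ->
    (fun n => (`|(x - r n) t|)%:E) @ \oo --> 0%E}.
  apply: filterS sx => t st _; apply: cvg_EFin; first exact: nearW.
  have xs : (fun n => `|x t - s n t|) @ \oo --> 0.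
    rewrite -(@normr0 _ X) -(subrr (x t)).
    by apply: cvg_norm; apply: cvgB => //; exact: cvg_cst.
  apply: squeeze_cvgr (cvg_cst 0) xs.
  by apply: nearW => n /=; rewrite normr_ge0 rs.
have i3 : mu.-integrable [set: S] (EFin \o (fun t => 3 * `|x t|)).
  by apply: integrable_realZ => //; exact: integrable_L1.
have mr n : measurable_fun [set: S] (fun t => (`|(x - r n) t|)%:E).
  by apply: measurable_int; apply: integrable_L1; exact: L1_predB.
have dom : {ae mu, forall t n, [set: S] t ->
    (`| (`|(x - r n) t|)%:E | <= (3 * `|x t|)%:E)%E}.
  apply: aeW => t n _; rewrite lee_fin normr_id.
  by have := ler_normB (x t) (r n t); have := r2 n t; lra.
have [_ _] := dominated_convergence measurableT mr (measurable_cst _) rx i3 dom.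
rewrite integral0 => /fine_cvgP[_ /cvgr_lt /(_ e e0)] [n _ /(_ n (leqnn n)) ne].
by exists (r n).
Qed.

(** An approximation [s] within [e / 2] has norm at most [1 + e / 2]. Dividing it by [1 + e / 2]
    brings it into the ball and moves it by at most another [e / 2]. *)
Lemma L1_simple_approx_ball (x : S -> X) (e : R) :
  L1_pred mu x -> L1_norm mu x <= 1 -> 0 < e ->
  exists s, [/\ finite_valued s, L1_pred mu s, L1_norm mu s <= 1 &
                L1_norm mu (x - s) < e].
Proof.
move=> Lx x1 e0; have e20 : 0 < e / 2 by rewrite divr_gt0.
have [s [fs Ls xs]] := L1_simple_approx Lx e20.
have L0 : L1_pred mu (0 : S -> X).
  by rewrite -(subrr x); exact: L1_predB.
have subf0 (f : S -> X) : f - 0 = f by rewrite subr0.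
have distC (f g : S -> X) : L1_norm mu (f - g) = L1_norm mu (g - f).
  by rewrite !L1_normE; apply: eq_Rintegral => t _; exact: distrC.
have s1 : L1_norm mu s <= 1 + e / 2.
  have := L1_norm_triangle Ls Lx L0; rewrite !subf0 distC; lra.
pose c := (1 + e / 2)^-1.
have c0 : 0 < c by rewrite invr_gt0; lra.
have ce : c * (1 + e / 2) = 1 by rewrite /c mulVf// gt_eqF//; lra.
clearbody c.
have Lcs : L1_pred mu (c *: s) by exact: L1_predZ.
exists (c *: s); split => //.
- exact: (finite_valued_comp (fun x => c *: x) fs).
- by rewrite L1_normZ// gtr0_norm// -ce ler_wpM2l// ltW.
- apply: le_lt_trans (L1_norm_triangle Lx Ls Lcs) _.
  have -> : s - c *: s = (1 - c) *: s by rewrite scalerBl scale1r.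
  have c1 : 0 <= 1 - c by nra.
  rewrite L1_normZ// ger0_norm//.
  have : (1 - c) * L1_norm mu s <= (1 - c) * (1 + e / 2) by rewrite ler_wpM2l.
  nra.
Qed.

End L1.

(** * The property for L^1 *)

Lemma property_ss_L1 (R : realType) (d : measure_display) (S : measurableType d)
    (mu : {measure set S -> \bar R}) (X : completeNormedModType R) :
  measure_is_complete mu -> banach_property_ss X ->
  property_ss (L1_pred mu) (@L1_norm R d S X mu).
Proof.
move=> cmu ssX.
apply/property_ssP => [f|x1 x2 Lx1 Lx2 n1 n2 eps eps0].
  by rewrite L1_normE; exact: Rintegral_ge0.
(* Each of the estimates below loses at most [3 * e]: from the approximations by [s1] and [s2], and
   from the tolerance [e] of the witnesses in [X]. *)
pose e := eps / 4; have e0 : 0 < e by rewrite divr_gt0.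
have epsE : eps = 4 * e by rewrite /e; lra.
have [|s1 [fs1 Ls1 s11 xs1]] := L1_simple_approx_ball cmu Lx1 _ e0.
  by rewrite n1.
have [|s2 [fs2 Ls2 s21 xs2]] := L1_simple_approx_ball cmu Lx2 _ e0.
  by rewrite n2.
(* The choice is made for each pair of values and not for each [t]. Thus [y], [z] and [z'] factor
   through the finite-valued map [p], and their measurability needs no selection theorem. *)
have /choice[w wP] : forall q : X * X, exists w : (X -> R) * (X * X),
    ss_witness e `|q.2| q.1 q.2 w.1 w.2.1 w.2.2.
  move=> q; have [f [z [z' h]]] := ss_witness_norm q.1 q.2 ssX e0.
  by exists (f, (z, z')).
pose p t := (s1 t, s2 t).
have fp : finite_valued p by exact: finite_valued_pair.
pose y t : X -> R := (w (p t)).1.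
pose z t : X := (w (p t)).2.1.
pose z' t : X := (w (p t)).2.2.
have wit t : ss_witness e `|s2 t| (s1 t) (s2 t) (y t) (z t) (z' t).
  exact: (wP (p t)).
have yb t : dual_ball (y t) by case: (wit t).
have fz : finite_valued z.
  by exact: (finite_valued_comp (fun q => (w q).2.1) fp).
have fz' : finite_valued z'.
  by exact: (finite_valued_comp (fun q => (w q).2.2) fp).
have zs t : `|z t| <= `|s2 t| by case: (wit t) => _ _ [].
have zs' t : `|z' t| <= `|s2 t| by case: (wit t) => _ _ [].
have is2 := integrable_L1 cmu Ls2; have is1 := integrable_L1 cmu Ls1.
have Lz : L1_pred mu z.
  by apply: le_L1_pred is2 zs => //; exact: strongly_measurable_simple.
have Lz' : L1_pred mu z'.
  by apply: le_L1_pred is2 zs' => //; exact: strongly_measurable_simple.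
have iy g : L1_pred mu g ->
    mu.-integrable [set: S] (EFin \o (fun t => y t (g t))).
  move=> Lg; apply: le_integrable (integrable_L1 cmu Lg) => //.
    apply/measurable_EFinP.
    apply: (measurable_finite_valued (h := fun q t => (w q).1 (g t)) fp) => q.
    apply: (measurable_comp_strongly_measurable (psi := (w q).1) cmu).
      by apply: dual_ball_continuous; case: (wP q).
    by case: Lg.
  by move=> t _; rewrite lee_fin normr_id; case: (yb t).
have L12 := integrable_L1 cmu (L1_predB cmu Lx1 Ls1).
have L22 := integrable_L1 cmu (L1_predB cmu Lx2 Ls2).
have ix1 := integrable_L1 cmu Lx1; have ix2 := integrable_L1 cmu Lx2.
pose f g := \int[mu]_t y t (g t).
have fge g : L1_pred mu g -> (forall t, (1 - e) * `|s2 t| <= y t (g t)) ->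
    1 - 4 * e < f g.
  move=> Lg gs.
  (* Only an upper bound on the norm of [s2] is at hand, so [|s2 t|] is bounded below through [x2],
     whose norm is exactly 1. *)
  have : \int[mu]_t (`|x2 t| - `|(x2 - s2) t| - e * `|s2 t|) <= f g.
    apply: le_Rintegral => //; [|exact: iy|].
      by do ?apply: integrable_realB => //; exact: integrable_realZ.
    move=> t _; apply: le_trans (gs t).
    by have := lerB_dist (x2 t) (s2 t); rewrite /= -/((x2 - s2) t); lra.
  rewrite RintegralB//; [|exact: integrable_realB|exact: integrable_realZ].
  rewrite RintegralB//.
  rewrite RintegralZl// -!L1_normE n2.
  have : e * L1_norm mu s2 <= e by rewrite ler_piMr// ltW.
  lra.
have zge t : (1 - e) * `|s2 t| <= y t (z t) by case: (wit t) => _ _ _ [].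
have zge' t : (1 - e) * `|s2 t| <= y t (z' t) by case: (wit t) => _ _ _ [].
have leN (g : S -> X) : L1_pred mu g -> (forall t, `|g t| <= `|s2 t|) ->
    L1_norm mu g <= 1.
  move=> Lg gs; apply: le_trans s21; rewrite !L1_normE.
  by apply: le_Rintegral => //; exact: integrable_L1.
exists f, z, z'; rewrite epsE; split.
- split.
  + move=> g h Lg Lh; rewrite /f -RintegralD//; try exact: iy.
    by apply: eq_Rintegral => t _; have [yD _ _] := yb t; exact: yD.
  + move=> a g Lg; rewrite /f -RintegralZl//; last exact: iy.
    by apply: eq_Rintegral => t _; have [_ yZ _] := yb t; exact: yZ.
  + move=> g Lg; apply: le_trans.
    apply: le_trans (le_normr_Rintegral measurableT (iy g Lg)) _.
    rewrite L1_normE; apply: le_Rintegral => //; last first.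
    * by move=> t _; have [_ _ y1] := yb t; exact: y1.
    * exact: integrable_L1.
    * exact: (integrable_norm (iy g Lg)).
(* Passing from [x1] to [s1] costs [|(x1 - s1) t|] twice: once inside [y t], and once in the lower
   bound of [|s1 t|] by [|x1 t|]. *)
- have : \int[mu]_t (`|x1 t| - 2 * `|(x1 - s1) t| - e * `|s1 t|) <= f x1.
    apply: le_Rintegral => //; [|exact: iy|].
      by do 2 (apply: integrable_realB => //; last exact: integrable_realZ).
    move=> t _; have [yD _ y1] := yb t; have [_ ys _ _ _] := wit t.
    have := dual_ballB (x1 t) (s1 t) (yb t).
    have := lerB_dist (x1 t) (s1 t).
    have := y1 (x1 t - s1 t); rewrite ler_norml => /andP[].
    rewrite /= -/((x1 - s1) t); lra.
  rewrite RintegralB//; [|apply: integrable_realB => //|];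
    try exact: integrable_realZ.
  rewrite RintegralB//; last exact: integrable_realZ.
  rewrite !RintegralZl// -!L1_normE n1.
  have : e * L1_norm mu s1 <= e by rewrite ler_piMr// ltW.
  lra.
- by split; [|exact: leN|exact: fge].
- by split; [|exact: leN|exact: fge].
- have i1 := integrable_L1 cmu (L1_predB cmu Lx2 Lz).
  have := integrable_L1 cmu (L1_predB cmu Lx2 (L1_predN cmu Lz')).
  rewrite opprK => i2.
  rewrite !L1_normE -RintegralD//.
  (* Both distances are measured through [s2 t], which gives the factor 2; the rest is the witness
     inequality at radius [|s2 t|]. *)
  apply: (@le_lt_trans _ _
    (\int[mu]_t (2 * `|(x2 - s2) t| + (2 + e) * `|s2 t|))).
    apply: le_Rintegral => //; [exact: integrable_realD| |].
      by apply: integrable_realD => //; exact: integrable_realZ.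
    move=> t _; have [_ _ _ _ vz] := wit t.
    have := ler_distD (s2 t) (x2 t) (z t).
    have := ler_distD (s2 t) (x2 t) (- z' t); rewrite !opprK.
    rewrite /= -/((x2 - s2) t) -/((x2 - z) t) -/((x2 + z') t); lra.
  rewrite RintegralD//; [|exact: integrable_realZ|exact: integrable_realZ].
  rewrite !RintegralZl// -!L1_normE.
  have : (2 + e) * L1_norm mu s2 <= 2 + e by rewrite ler_piMr//; lra.
  lra.
Qed.

(** * Subsets of positive measure *)

Section positive_pieces.
Context (R : realType) (d : measure_display) (S : measurableType d)
        (mu : {measure set S -> \bar R}).

Lemma negligible_finite_bigcup (T : choiceType) (D : set T) (F : T -> set S) :
  finite_set D -> (forall x, D x -> mu.-negligible (F x)) ->
  mu.-negligible (\bigcup_(x in D) F x).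
Proof.
move=> /finite_seqP[s ->] nF; rewrite bigcup_seq.
rewrite big_seq; elim/big_ind : _ => [|A B|x xs].
- exact: negligible_set0.
- exact: negligibleU.
- exact: nF.
Qed.

Lemma measure_gt0_not_negligible (A : set S) :
  measurable A -> ~ mu.-negligible A -> (0 < mu A)%E.
Proof.
by move=> mA nA; rewrite measure_gt0; apply/eqP => A0; apply/nA/negligibleP.
Qed.

Lemma not_negligible_measure_gt0 (A : set S) :
  measurable A -> (0 < mu A)%E -> ~ mu.-negligible A.
Proof.
by move=> mA; rewrite measure_gt0 => /eqP A0 /(negligibleP mu mA).
Qed.

(** Otherwise [A] would meet each of the countably many sets of finite measure that exhaust the
    space in a null set, and would be null itself. *)
Lemma positive_finite_piece (A : set S) :
  sigma_finite [set: S] mu -> measurable A -> (0 < mu A)%E ->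
  exists B, [/\ measurable B, B `<=` A, (0 < mu B)%E & (mu B < +oo)%E].
Proof.
move=> [F FT mF] mA A0; apply: contrapT => nB.
apply: (not_negligible_measure_gt0 mA A0).
apply: (@negligibleS _ _ _ _ (\bigcup_n (A `&` F n))).
  move=> t At; have : [set: S] t by [].
  by rewrite FT => -[n _ Fnt]; exists n.
apply: negligible_bigcup => n; have [mFn Fnoo] := mF n.
have mAF : measurable (A `&` F n) by exact: measurableI.
apply: contrapT => /(measure_gt0_not_negligible mAF) AF0; apply: nB.
exists (A `&` F n); split => //.
by apply: le_lt_trans Fnoo; apply: le_measure => //; rewrite inE.
Qed.

(* Almost all of [A] is covered by the countably many sets on which [g] is close
   to a given value of one of its simple approximants. *)
Lemma positive_small_oscillation (X : normedModType R) (g : S -> X)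
    (A : set S) (e : R) :
  measure_is_complete mu -> strongly_measurable mu g ->
  measurable A -> (0 < mu A)%E -> 0 < e ->
  exists B, [/\ measurable B, B `<=` A, (0 < mu B)%E &
    forall s t, B s -> B t -> `|g s - g t| <= e].
Proof.
move=> cmu mg mA A0 e0; have [s [fs sg]] := mg.
apply: contrapT => nB; apply: (not_negligible_measure_gt0 mA A0).
pose C x := A `&` [set t | `|g t - x| <= e / 2].
have mC x : measurable (C x).
  apply: measurableI => //; rewrite -[X in measurable X]setTI.
  apply: measurable_fun_le => //.
  apply: (measurable_comp_strongly_measurable (psi := fun y => `|y - x|) cmu) mg.
  move=> y; apply: cvg_norm; apply: cvgB; [exact: cvg_id|exact: cvg_cst].
have nC x : mu.-negligible (C x).
  apply: contrapT => /(measure_gt0_not_negligible (mC x)) C0; apply: nB.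
  exists (C x); split => // [t []//|t t' [_ /= tx] [_ /= tx']].
  have := ler_distD x (g t) (g t'); rewrite (distrC x); lra.
apply: negligibleS (negligibleU sg (negligible_bigcup (F := fun n =>
  \bigcup_(x in range (s n)) C x) _)).
  move=> t At; have [st|nst] := pselect ((fun n => s n t) @ \oo --> g t).
    right; have e20 : 0 < e / 2 by rewrite divr_gt0.
    have /cvgrPdist_le /(_ _ e20) [n _ /(_ n (leqnn n)) /= sn] := st.
    by exists n => //; exists (s n t) => //; exists t.
  by left.
by move=> n; apply: negligible_finite_bigcup => //; case: (fs n).
Qed.

End positive_pieces.

(** * The space L^oo *)

Section Linfty.
Context (R : realType) (d : measure_display) (S : measurableType d)
        (mu : {measure set S -> \bar R}) (X : normedModType R).

(** A negative essential supremum of a norm is possible only if the whole space is null. It is then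
    [-oo], which [fine] sends to 0. *)
Lemma Linfty_norm_ge0 (f : S -> X) : 0 <= Linfty_norm mu f.
Proof.
rewrite /Linfty_norm.
have : (ess_sup mu (fun t => (`|f t|)%:E) <= -oo)%E \/
    (0 <= ess_sup mu (fun t => (`|f t|)%:E))%E.
  have [|s0] := leP 0%E (ess_sup mu (fun t => (`|f t|)%:E)); first by right.
  left; apply/ess_supP.
  apply: filterS (@ess_sup_ge _ _ _ mu (fun t => (`|f t|)%:E)) => t ft.
  by have := le_lt_trans ft s0; rewrite lte_fin ltNge normr_ge0.
by case=> [|/fine_ge0//]; rewrite leeNy_eq => /eqP ->.
Qed.

Lemma ae_le_Linfty_norm (f : S -> X) : Linfty_pred mu f ->
  {ae mu, forall t, `|f t| <= Linfty_norm mu f}.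
Proof.
move=> [_]; rewrite /Linfty_norm => foo.
apply: filterS (@ess_sup_ge _ _ _ mu (fun t => (`|f t|)%:E)) => t.
by case: (ess_sup _ _) foo => [r _|//|//]; rewrite lee_fin.
Qed.

Lemma Linfty_norm_le (f : S -> X) (M : R) : 0 <= M ->
  {ae mu, forall t, `|f t| <= M} -> Linfty_norm mu f <= M.
Proof.
move=> M0 fM; have : (ess_sup mu (fun t => (`|f t|)%:E) <= M%:E)%E.
  by apply/ess_supP; apply: filterS fM => t; rewrite lee_fin.
by rewrite /Linfty_norm; case: (ess_sup _ _) => [r||]//=; rewrite lee_fin.
Qed.

Lemma le_Linfty_pred (f : S -> X) (M : R) : strongly_measurable mu f ->
  {ae mu, forall t, `|f t| <= M} -> Linfty_pred mu f.
Proof.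
move=> mf fM; split => //; apply: le_lt_trans (ltry M).
by apply/ess_supP; apply: filterS fM => t; rewrite lee_fin.
Qed.

Lemma Linfty_predN (f : S -> X) : Linfty_pred mu f -> Linfty_pred mu (- f).
Proof.
move=> Lf; have [mf _] := Lf.
apply: (le_Linfty_pred (M := Linfty_norm mu f)).
  exact: strongly_measurableN.
by apply: filterS (ae_le_Linfty_norm Lf) => t; rewrite normrN.
Qed.

(** Since [B] has finite measure, the constant [M] is an integrable bound. The second conclusion
    makes averages over [B] contractions for the L^oo norm. *)
Lemma integrable_ae_bounded (B : set S) (h : S -> R) (M : R) :
  measurable B -> (mu B < +oo)%E -> measurable_fun B h -> 0 <= M ->
  {ae mu, forall t, `|h t| <= M} ->
  mu.-integrable B (EFin \o h) /\ `|\int[mu]_(t in B) h t| <= M * fine (mu B).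
Proof.
move=> mB Boo mh M0 hM.
have le : (\int[mu]_(t in B) `|(h t)%:E| <= M%:E * mu B)%E.
  rewrite -integral_cst//; apply: ae_ge0_le_integral => //.
  - by apply/measurable_EFinP; exact: measurableT_comp.
  - by apply: filterS hM => t hM _; rewrite lee_fin.
have MBoo : (M%:E * mu B < +oo)%E.
  by rewrite -(@fineK _ (mu B)) ?ge0_fin_numE// -EFinM ltry.
have ih : mu.-integrable B (EFin \o h).
  apply/integrableP; split; first exact/measurable_EFinP.
  exact: le_lt_trans MBoo.
split => //; rewrite -lee_fin EFin_normr_Rintegral//.
rewrite EFinM fineK; last by rewrite ge0_fin_numE.
apply: le_trans le; apply: le_abse_integral => //.
exact/measurable_EFinP.
Qed.

End Linfty.

(** * The property for L^oo *)

Lemma property_ss_Linfty (R : realType) (d : measure_display)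
    (S : measurableType d) (mu : {measure set S -> \bar R})
    (X : completeNormedModType R) :
  measure_is_complete mu -> sigma_finite [set: S] mu -> banach_property_ss X ->
  property_ss (Linfty_pred mu) (@Linfty_norm R d S X mu).
Proof.
move=> cmu smu ssX.
apply/property_ssP => [|x1 x2 Lx1 Lx2 n1 n2 eps eps0].
  exact: Linfty_norm_ge0.
(* The cap [1 / 2] keeps [1 - e] positive, so that [x1] does not vanish where its norm exceeds
   [1 - e]. *)
pose e := Num.min (eps / 4) (1 / 2).
have e0 : 0 < e by rewrite lt_min divr_gt0//=; lra.
have eeps : 4 * e <= eps.
  have : e <= eps / 4 by rewrite ge_min lexx.
  lra.
have e1 : e <= 1 / 2 by rewrite ge_min lexx orbT.
clearbody e.
have [mx1 _] := Lx1; have [mx2 _] := Lx2.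
have ae1 := ae_le_Linfty_norm Lx1; have ae2 := ae_le_Linfty_norm Lx2.
rewrite n1 in ae1; rewrite n2 in ae2.
pose A := ~` [set t | `|x1 t| <= 1 - e].
have mA : measurable A.
  apply: measurableC; rewrite -[X in measurable X]setTI.
  apply: measurable_fun_le => //.
  exact: (measurable_norm_strongly_measurable cmu mx1).
have A0 : (0 < mu A)%E.
  apply: measure_gt0_not_negligible => // nA.
  have : Linfty_norm mu x1 <= 1 - e by apply: Linfty_norm_le => //; lra.
  by rewrite n1; lra.
(* [A] is shrunk three times, keeping positive measure: to finite measure, then to small oscillation
   of [x1], then of [x2]. *)
have [B1 [mB1 B1A B10 B1oo]] := positive_finite_piece smu mA A0.
have [B2 [mB2 B21 B20 osc1]] := positive_small_oscillation cmu mx1 mB1 B10 e0.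
have [B [mB B2B B0 osc2]] := positive_small_oscillation cmu mx2 mB2 B20 e0.
have Boo : (mu B < +oo)%E.
  apply: le_lt_trans B1oo; apply: le_measure; rewrite ?inE//.
  exact: subset_trans B21.
(* The norm bounds hold only almost everywhere, but [B] is not null and so contains a point where
   both hold. The values there stand for [x1] and [x2] on all of [B]. *)
have [t0 [Bt0 u1 v1]] : exists t0, [/\ B t0, `|x1 t0| <= 1 & `|x2 t0| <= 1].
  apply: contrapT => no; apply: (not_negligible_measure_gt0 mB B0).
  apply: negligibleS (filterI ae1 ae2) => t Bt [h1 h2]; apply: no.
  by exists t.
have u0 : 1 - e < `|x1 t0|.
  by rewrite ltNge; apply/negP; exact: (B1A _ (B21 _ (B2B _ Bt0))).
have ux0 : x1 t0 != 0 by rewrite -normr_gt0; lra.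
have [y [z [z' [yb yu [z1 z1'] [yz yz'] vz]]]] := ss_witness_ball ssX ux0 v1 e0.
have [yD yZ y1] := yb.
pose m := fine (mu B).
have m0 : 0 < m by rewrite fine_gt0// B0.
have int_cst (c : R) : \int[mu]_(t in B) c = c * m by exact: Rintegral_cst.
have my g : Linfty_pred mu g -> measurable_fun B (y \o g).
  move=> [mg _]; apply: measurable_funTS.
  exact: (measurable_comp_strongly_measurable cmu (dual_ball_continuous yb) mg).
have bnd g : Linfty_pred mu g -> mu.-integrable B (EFin \o (y \o g)) /\
    `|\int[mu]_(t in B) y (g t)| <= Linfty_norm mu g * m.
  move=> Lg; apply: integrable_ae_bounded => //; first exact: my.
    exact: Linfty_norm_ge0.
  by apply: filterS (ae_le_Linfty_norm Lg) => t; apply: le_trans (y1 _).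
clearbody m.
pose f g := m^-1 * \int[mu]_(t in B) y (g t).
(* The functional [f] sees only [B], where the patched function is the constant [c], so its value is
   [y c]; the distance to [g] also comes from [B] alone. *)
pose patch c g : S -> X := fun t => if t \in B then c else g t.
have Lpatch c g : `|c| <= 1 -> Linfty_pred mu g -> Linfty_norm mu g <= 1 ->
    Linfty_pred mu (patch c g) /\ Linfty_norm mu (patch c g) <= 1.
  move=> c1 Lg g1; have [mg _] := Lg.
  have ae : {ae mu, forall t, `|patch c g t| <= 1}.
    apply: filterS (ae_le_Linfty_norm Lg) => t gt.
    by rewrite /patch; case: ifP => // _; exact: le_trans g1.
  split; last exact: Linfty_norm_le.
  by apply: le_Linfty_pred ae; exact: strongly_measurable_if.
have fpatch c g : f (patch c g) = y c.
  rewrite /f (@eq_Rintegral _ _ _ _ _ (fun=> y c)); last first.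
    by move=> t tB; rewrite /patch tB.
  by rewrite int_cst mulrCA mulVf ?mulr1// gt_eqF.
have Npatch c : Linfty_norm mu (x2 - patch c x2) <= e + `|x2 t0 - c|.
  have ec : 0 <= e + `|x2 t0 - c| by rewrite addr_ge0// ltW.
  apply: Linfty_norm_le => //; apply: aeW => t.
  have -> : (x2 - patch c x2) t = x2 t - patch c x2 t by [].
  rewrite /patch.
  case: ifPn => [/set_mem Bt|_]; last by rewrite subrr normr0.
  apply: le_trans (ler_distD (x2 t0) _ _) _.
  by rewrite lerD2r osc2.
have Lx2N := Linfty_predN Lx2.
have n2N : Linfty_norm mu (- x2) <= 1.
  by apply: Linfty_norm_le => //; apply: filterS ae2 => t; rewrite normrN.
have [Lz Nz] : Linfty_pred mu (patch z x2) /\ Linfty_norm mu (patch z x2) <= 1.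
  by apply: Lpatch => //; rewrite n2.
(* Here [- x2] is patched, so that the sum of [x2] and the patched function vanishes off [B]. *)
have [Lz' Nz'] := Lpatch z' (- x2) z1' Lx2N n2N.
exists f, (patch z x2), (patch z' (- x2)); split.
- split.
  + move=> g h Lg Lh; have [ig _] := bnd g Lg; have [ih _] := bnd h Lh.
    rewrite /f -mulrDr -RintegralD//; congr (_ * _).
    by apply: eq_Rintegral => t _; exact: yD.
  + move=> a g Lg; have [ig _] := bnd g Lg.
    rewrite /f mulrCA; congr (_ * _); rewrite -RintegralZl//.
    by apply: eq_Rintegral => t _; exact: yZ.
  + move=> g Lg Ng; have [_] := bnd g Lg.
    rewrite /f normrM normfV (gtr0_norm m0) ler_pdivrMl// mulr1 => h.
    by apply: le_trans h _; rewrite ler_piMl// ltW.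
- have [ix _] := bnd x1 Lx1.
  rewrite /f ltr_pdivlMl// mulrC.
  (* A lower bound of [y (x1 t)] on [B]: the witness bound at [t0], less the oscillation [e] of
     [x1]. It exceeds [(1 - e)^2 - e], hence [1 - 3 * e]. *)
  pose c := (1 - e) * `|x1 t0| - e.
  apply: (@lt_le_trans _ _ (\int[mu]_(t in B) c)).
    by rewrite int_cst ltr_pM2r// /c; nra.
  apply: le_Rintegral => //.
    by case: (@integrable_ae_bounded _ _ _ mu B (cst c) `|c|) => //; exact: aeW.
  move=> t Bt; apply: (@le_trans _ _ (y (x1 t0) - e)); first by rewrite lerD2r.
  rewrite lerBlDr -lerBlDl -dual_ballB//.
  apply: le_trans (ler_norm _) _; apply: le_trans (y1 _) _.
  by apply: osc1; exact: B2B.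
- by split => //; rewrite fpatch; lra.
- by split => //; rewrite fpatch; lra.
(* Each distance exceeds the one at [t0] by at most [e], for a total of at most [2 + 3 * e]. *)
- have Nz2 := Npatch z; have Nz2' := Npatch (- z').
  have E : x2 + patch z' (- x2) = x2 - patch (- z') x2.
    apply/funext => t.
    have -> : (x2 - patch (- z') x2) t = x2 t - patch (- z') x2 t by [].
    have -> : (x2 + patch z' (- x2)) t = x2 t + patch z' (- x2) t by [].
    by rewrite /patch; case: ifP => // _; rewrite opprK.
  by move: Nz2 Nz2' vz; rewrite opprK E; lra.
Qed.

Theorem theorem4p8 (R : realType) (d : measure_display) (S : measurableType d)
  (mu : {measure set S -> \bar R}) (X : completeNormedModType R) :
  measure_is_complete mu -> sigma_finite [set: S] mu ->
  banach_property_ss X ->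
  property_ss (L1_pred mu) (@L1_norm R d S X mu) /\
  property_ss (Linfty_pred mu) (@Linfty_norm R d S X mu).
Proof.
by move=> cmu smu ssX; split; [exact: property_ss_L1|exact: property_ss_Linfty].
Qed.
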